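(* Let $n, m, k, s$ be positive integers such that $1 \leq s \leq n-1$ and $1 < k < (m-1)n - 1$. Then there is an $s$-ocycle for $\mathcal{B}_k(m,n)$ if and only if $n - s > \gcd(n,s)$.
   Context: An $m$-ary word (string) of length $n$ is a sequence $x = x_1x_2\ldots x_n$ with each $x_i \in \{0,1,\ldots,m-1\}$. Its weight is $wt(x) = \sum_{i=1}^n x_i$ (sum of integers). $\mathcal{B}_k(m,n)$ denotes the set of all $m$-ary words of length $n$ and weight $k$. For a set $S$ of strings of length $n$ and an integer $s$ with $1 \le s \le n-1$, an $s$-overlap cycle ($s$-ocycle) for $S$ is a cyclic ordering of $S$, in which each element of $S$ appears exactly once, such that whenever $x = x_1\ldots x_n$ is followed by $y = y_1 \ldots y_n$ one has $x_{n-s+i} = y_i$ for all $i \in \{1,\ldots,s\}$ (the last $s$ letters of $x$ equal the first $s$ letters of $y$). The ordering being cyclic means that the last element of the ordering is followed by the first, and the overlap condition is also required there. *)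

(* Defs.v *)
From mathcomp Require Import all_boot.

Set Implicit Arguments.
Unset Strict Implicit.
Unset Printing Implicit Defensive.

Definition wt (m n : nat) (x : n.-tuple 'I_m) : nat :=
  \sum_(i < n) tnth x i.

Definition words_of_weight (k m n : nat) : {set n.-tuple 'I_m} :=
  [set x | wt x == k].

(* Intended for s <= n, as [drop (n - s) x] then has exactly s letters. *)
Definition overlap (T : eqType) (n s : nat) : rel (n.-tuple T) :=
  fun x y => drop (n - s) x == take s y.

(* [cycle] also relates the last element of [c] to its first one. *)
Definition is_ocycle (T : finType) (n s : nat) (S : {set n.-tuple T})
    (c : seq (n.-tuple T)) : Prop :=
  [/\ uniq c, c =i S & cycle (overlap s) c].

(* Main.v *)
Require Import Defs.
From mathcomp Require Import all_boot fingroup perm zify.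

(* Words are the edges of a digraph on words of length s, from prefix to suffix,
   and an s-ocycle is an Euler circuit.  Rotation by n - s is a permutation
   sending each word to a possible successor, so only connectivity matters.
   A class of words closed under succession is closed under rotations by
   multiples of d = gcd(n, s) and under rearranging the first n - s letters at
   constant weight.  If n - s > d, then n - s >= 2d, so a unit can be moved
   between any two adjacent letters, and every word can be packed to the left.
   If n - s = d, the overlap condition merely rotates the cyclic sequence of the
   weights of the n / d blocks of length d, whereas two words of weight k can
   be found whose block weights are not rotations of each other. *)

Set Implicit Arguments.
Unset Strict Implicit.
Unset Printing Implicit Defensive.

(* Euler's theorem for the digraph with an edge [src x -> tgt x] for each [x] in
   [S]: among the successor permutations, one with the fewest orbits visits all
   of [S] in one orbit, since a transposition could merge two touching orbits. *)
Lemma euler_circuit (T : finType) (V : eqType) (src tgt : T -> V) (S : {set T})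
    (f : T -> T) :
  injective f -> (forall x, (f x \in S) = (x \in S)) ->
  (forall x, src (f x) = tgt x) ->
  (forall A : {set T}, A != set0 -> A \subset S ->
     (forall x y, x \in A -> y \in S -> tgt x = src y -> y \in A) ->
     S \subset A) ->
  exists c, [/\ uniq c, c =i S & path.cycle (fun x y => tgt x == src y) c].
Proof.
move=> f_inj fS src_f connS.
have [->|[x0 x0S]] := set_0Vmem S; first by exists [::]; split=> // x; rewrite inE.
pose P (u : {perm T}) :=
  [forall x, (src (u x) == tgt x) && ((u x \in S) == (x \in S))].
have Pf : P (perm f_inj) by apply/forallP=> x; rewrite permE src_f fS !eqxx.
case: (arg_minnP (fun u : {perm T} => #|porbits u|) Pf) => u /forallP Pu u_min.
have src_u x : src (u x) = tgt x by case/andP: (Pu x) => /eqP.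
have uS x : (u x \in S) = (x \in S) by case/andP: (Pu x) => _ /eqP.
have OS : porbit u x0 \subset S.
  apply/subsetP=> y /porbitP[i ->]; elim: i => [|i IH]; first by rewrite perm1.
  by rewrite expgSr permM uS.
have SO : S \subset porbit u x0.
  apply: connS => //; first by apply/set0Pn; exists x0; apply: porbit_id.
  move=> x y xO yS xy; apply: contraT => yNO.
  pose z := (u^-1)%g y.
  have uz : u z = y by rewrite permKV.
  have zS : z \in S by rewrite -uS uz.
  have zNx : x \notin porbit u z.
    apply: contra yNO => xz; rewrite -eq_porbit_mem -uz.
    have := porbit_perm u 1 z; rewrite expg1 => ->.
    by rewrite -eq_porbit_mem in xz; rewrite -(eqP xz) eq_porbit_mem.
  have neq_xz : x != z by apply: contra zNx => /eqP->; apply: porbit_id.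
  have srczx : tgt z = tgt x by rewrite -src_u uz xy.
  have xS := subsetP OS x xO.
  (* Exchanging the successors of [x] and [z] preserves [P] because [tgt z = tgt x], and it merges
     their two distinct orbits, against minimality. *)
  suff /u_min : P (tperm x z * u)%g.
    have := porbits_mul_tperm u x z; rewrite /= zNx neq_xz => cardE.
    by rewrite -(leq_add2r 1) -cardE leq_add2l.
  apply/forallP=> w; rewrite permM src_u uS.
  by case: tpermP => [->|->|_ _]; rewrite ?srczx ?xS ?zS !eqxx.
exists (fingraph.orbit u x0); split; first exact: orbit_uniq.
  move=> y; rewrite -fconnect_orbit; apply/idP/idP => [/iter_findex <-|yS].
    by elim: (findex _ _ _) => //= i; rewrite uS.
  by have /porbitP[i ->] := subsetP SO y yS; rewrite permX fconnect_iter.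
have := cycle_orbit (@perm_inj _ u) x0.
by apply: sub_cycle => x y /eqP <-; rewrite src_u.
Qed.

(** * Words as letter functions: rotations, unit transfers, left-packed words *)

Section Words.

Variables m n : nat.
Implicit Types (x y z : n.-tuple 'I_m.+1) (f : nat -> nat).

Definition letter x i : nat := nth ord0 x i.

Definition word_of f : n.-tuple 'I_m.+1 := [tuple inord (f i) | i < n].

Lemma letter_le x i : letter x i <= m.
Proof. by rewrite -ltnS /letter ltn_ord. Qed.

Lemma eq_letter x y : (forall i, i < n -> letter x i = letter y i) -> x = y.
Proof.
move=> xy; apply: eq_from_tnth => i; apply: val_inj.
by rewrite !(tnth_nth ord0); apply: xy.
Qed.

Lemma letter_word f i : i < n -> f i <= m -> letter (word_of f) i = f i.
Proof.
move=> lt_in le_fm; rewrite /letter.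
have -> : i = Ordinal lt_in by [].
by rewrite -tnth_nth tnth_mktuple inordK.
Qed.

Lemma wtE x : wt x = \sum_(i < n) letter x i.
Proof. by apply: eq_bigr => i _; rewrite (tnth_nth ord0). Qed.

Lemma overlapP s x y : s <= n ->
  reflect (forall i, i < s -> letter x (n - s + i) = letter y i) (overlap s x y).
Proof.
move=> le_sn; apply: (iffP eqP) => [xy i lt_is|xy].
  by rewrite /letter -nth_drop xy nth_take.
apply: (@eq_from_nth _ ord0) => [|i]; rewrite size_drop size_tuple.
  by rewrite size_takel ?size_tuple // subKn.
rewrite subKn // => lt_is; rewrite nth_drop nth_take //.
exact: val_inj (xy i lt_is).
Qed.

Definition rotw r x := word_of (fun i => letter x ((i + r) %% n)).

Lemma letter_rotw r x i : i < n -> letter (rotw r x) i = letter x ((i + r) %% n).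
Proof. by move=> lt_in; rewrite letter_word ?letter_le. Qed.

Lemma rotw_add r r' x : rotw r (rotw r' x) = rotw (r + r') x.
Proof.
apply: eq_letter => i lt_in; rewrite !letter_rotw ?ltn_pmod ?(leq_ltn_trans _ lt_in) //.
by rewrite modnDml addnA.
Qed.

Lemma eq_rotw r r' x : r = r' %[mod n] -> rotw r x = rotw r' x.
Proof.
by move=> eq_r; apply: eq_letter => i ?; rewrite !letter_rotw // -modnDmr eq_r modnDmr.
Qed.

Lemma rotw0 x : rotw 0 x = x.
Proof. by apply: eq_letter => i ?; rewrite letter_rotw // addn0 modn_small. Qed.

Lemma rotwK r x : r <= n -> rotw (n - r) (rotw r x) = x.
Proof.
by move=> le_rn; rewrite rotw_add subnK // -[RHS]rotw0;
  apply: eq_rotw; rewrite modnn mod0n.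
Qed.

Lemma wt_rotw r x : wt (rotw r x) = wt x.
Proof.
rewrite !wtE; have [n0|n_gt0] := posnP n.
  by rewrite !big_pred0 // => -[i]; rewrite n0.
pose h (i : 'I_n) := Ordinal (ltn_pmod (i + r) n_gt0).
have h_inj : injective h.
  move=> i j [] /eqP; rewrite eqn_modDr !modn_small // => /eqP; exact: val_inj.
rewrite [RHS](reindex_inj h_inj); apply: eq_bigr => i _; exact: letter_rotw.
Qed.

(** The indicators of [p] and [q] stand on opposite sides so that the balance is exact in [nat],
    whichever of the two positions the interval contains. *)
Lemma sum_transfer f p q a b : p != q -> 0 < f p ->
  \sum_(a <= i < b) (f i - (i == p) + (i == q)) + (a <= p < b)
  = \sum_(a <= i < b) f i + (a <= q < b).
Proof.
move=> neq_pq f_gt0.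
have delta r : (a <= r < b) = \sum_(a <= i < b) (i == r) :> nat.
  rewrite -mem_index_iota -count_uniq_mem ?iota_uniq // -sum1_count big_mkcond.
  by apply: eq_bigr => i _ /=; case: eqP.
rewrite !delta -!big_split /=; apply: eq_bigr => i _.
by case: eqP => [->|_]; [rewrite (negbTE neq_pq)|case: eqP]; lia.
Qed.

Definition transfer p q x := word_of (fun i => letter x i - (i == p) + (i == q)).

Lemma letter_transfer p q x i : p != q -> letter x q < m -> i < n ->
  letter (transfer p q x) i = letter x i - (i == p) + (i == q).
Proof.
move=> neq_pq ltq lt_in; rewrite letter_word //; have := letter_le x i.
by case: (i =P q) => [->|]; rewrite 1?eq_sym ?(negbTE neq_pq); lia.
Qed.

Lemma wt_transfer p q x : p != q -> 0 < letter x p -> letter x q < m ->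
  p < n -> q < n -> wt (transfer p q x) = wt x.
Proof.
move=> neq_pq x_gt0 lt_xm lt_pn lt_qn; rewrite !wtE.
rewrite (eq_bigr (fun i : 'I_n => letter x i - (i == p :> nat) + (i == q :> nat)));
  last by move=> i _; rewrite letter_transfer.
rewrite -!(big_mkord xpredT (fun i => _ i)).
have := sum_transfer 0 n neq_pq x_gt0; rewrite !big_mkord lt_pn lt_qn /=; lia.
Qed.

(** These are the words m ... m a 0 ... 0. *)
Definition left_packed x :=
  forall p, p.+1 < n -> letter x p < m -> letter x p.+1 = 0.

Lemma left_packed_tail x i j :
  left_packed x -> letter x i < m -> i < j < n -> letter x j = 0.
Proof.
move=> xP lt_xm /andP[lt_ij lt_jn].
elim: j lt_ij lt_jn => // j IH; rewrite ltnS leq_eqVlt => /predU1P[<-|lt_ij] lt_jn.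
  exact: xP.
by apply: xP => //; rewrite IH //; lia.
Qed.

(** If [y] had the larger letter at [i], then [x] would have a letter below [m] there, hence only
    zeros afterwards, and [y] would outweigh [x]. *)
Lemma left_packed_le x y i : left_packed x -> wt x = wt y -> i < n ->
  (forall j, j < i -> letter x j = letter y j) -> letter y i <= letter x i.
Proof.
move=> xP eq_wt lt_in eq_xy; rewrite leqNgt; apply/negP => lt_xy.
suff : wt x < wt y by rewrite eq_wt ltnn.
rewrite !wtE (bigD1 (Ordinal lt_in)) // [ltnRHS](bigD1 (Ordinal lt_in)) //=.
rewrite -addSn leq_add // leq_sum // => j _.
have [/eq_xy->//|lt_ij|->] := ltngtP j i; last exact: ltnW.
by rewrite (left_packed_tail xP (leq_trans lt_xy (letter_le y i))) // lt_ij /=.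
Qed.

Lemma left_packed_inj x y :
  left_packed x -> left_packed y -> wt x = wt y -> x = y.
Proof.
move=> xP yP eq_wt; apply: eq_letter; elim/ltn_ind => i IH lt_in.
apply/eqP; rewrite eqn_leq !left_packed_le // => j lt_ji; rewrite IH //; lia.
Qed.

(** Each leftward transfer lowers the moment [pot] by one, so a word of least moment in [B] admits
    none. *)
Lemma left_packed_exists (B : {set n.-tuple 'I_m.+1}) : B != set0 ->
  (forall x p, x \in B -> p.+1 < n -> letter x p < m -> 0 < letter x p.+1 ->
     transfer p.+1 p x \in B) ->
  exists2 x, x \in B & left_packed x.
Proof.
case/set0Pn=> x0 x0B closB.
pose pot x := \sum_(i < n) i * letter x i.
case: (arg_minnP pot x0B) => x xB x_min; exists x => // p lt_pn lt_xm.
apply/eqP; rewrite -leqn0 leqNgt; apply/negP => x_gt0.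
have := x_min _ (closB x p xB lt_pn lt_xm x_gt0); apply/negP; rewrite -ltnNge.
have sum_delta r : r < n -> \sum_(i < n) i * (i == r :> nat) = r.
  move=> lt_rn; rewrite (bigD1 (Ordinal lt_rn)) //= eqxx muln1 big1 ?addn0 //.
  by move=> i; rewrite -val_eqE /= => /negbTE->; rewrite muln0.
suff : pot (transfer p.+1 p x) + \sum_(i < n) i * (i == p.+1 :> nat)
       = pot x + \sum_(i < n) i * (i == p :> nat).
  by rewrite !sum_delta ?(ltnW lt_pn) //; lia.
rewrite -!big_split; apply: eq_bigr => i _ /=.
rewrite -!mulnDr letter_transfer //; last by lia.
by congr (_ * _); case: (i =P p.+1 :> nat) => [->|]; lia.
Qed.

End Words.

(** * Connectivity of the overlap digraph when n - s > gcd(n, s) *)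

Section Connectivity.

Variables m n s k : nat.
Hypotheses (lt_sn : s < n) (gcd_lt : gcdn n s < n - s).
Variable A : {set n.-tuple 'I_m.+1}.
Hypothesis AS : A \subset words_of_weight k m.+1 n.
Hypothesis A_closed : forall x y,
  x \in A -> y \in words_of_weight k m.+1 n -> overlap s x y -> y \in A.
Implicit Types x y : n.-tuple 'I_m.+1.

(** Rotation by [n - s] yields a successor, and by Bezout its iterates realise, modulo [n], every
    multiple of the gcd. *)
Lemma closed_rotw_gcd r x : gcdn n s %| r -> x \in A -> rotw r x \in A.
Proof.
have rot1 y : y \in A -> rotw (n - s) y \in A.
  move=> yA; apply: (A_closed yA).
    by have := subsetP AS y yA; rewrite !inE wt_rotw.
  apply/overlapP; first exact: ltnW.
  by move=> i lt_is; rewrite letter_rotw; [rewrite modn_small|]; [congr letter| |]; lia.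
have rotM a y : y \in A -> rotw (a * (n - s)) y \in A.
  elim: a => [|a IH] yA; first by rewrite rotw0.
  by rewrite mulSn -rotw_add rot1 ?IH.
case/dvdnP=> b -> xA; have sn_gt0 : 0 < n - s by lia.
case: (egcdnP n sn_gt0) => u v uvE _.
have gcdE : gcdn (n - s) n = gcdn n s.
  by rewrite -{2 3}(subnK (ltnW lt_sn)) gcdnDl [RHS]gcdnC gcdnDr gcdnC.
suff <- : rotw (b * u * (n - s)) x = rotw (b * gcdn n s) x by apply: rotM.
by apply: eq_rotw; rewrite -mulnA uvE gcdE mulnDr mulnA modnMDl.
Qed.

(** Only the last [s] letters of [x] constrain its successors, so [rotw (n - s) y] is one of them;
    rotating by [s] then restores [y]. *)
Lemma closed_prefix x y : x \in A -> wt x = wt y ->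
  (forall i, n - s <= i < n -> letter x i = letter y i) -> y \in A.
Proof.
move=> xA eq_wt eq_xy.
rewrite -(rotwK y (leq_subr s n)) (subKn (ltnW lt_sn)).
apply: closed_rotw_gcd; first exact: dvdn_gcdr.
apply: (A_closed xA).
  by have := subsetP AS x xA; rewrite !inE wt_rotw -eq_wt.
apply/overlapP; first exact: ltnW.
move=> i lt_is; rewrite letter_rotw ?modn_small; try lia.
by rewrite addnC eq_xy //; lia.
Qed.

(* Rotating by a multiple of [gcdn n s] brings two adjacent positions into the
   freely modifiable prefix, which has length at least [2 * gcdn n s]. *)
Lemma closed_adjacent x y p : x \in A -> wt x = wt y -> p.+1 < n ->
  (forall i, i < n -> i != p -> i != p.+1 -> letter x i = letter y i) -> y \in A.
Proof.
move=> xA eq_wt lt_pn eq_xy; set d := gcdn n s.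
have d_gt0 : 0 < d by rewrite gcdn_gt0; lia.
(* [r] starts the length-[d] block containing [p]; rotation by [r] brings [p.+1] to position at most
   [d], inside the prefix. *)
pose r := p %/ d * d.
have le_rp : r <= p by apply: leq_divM.
have lt_pr : p < r + d by rewrite addnC -mulSn ltn_ceil.
have dr : d %| r by apply: dvdn_mull.
have dn : d %| n by apply: dvdn_gcdl.
have d2 : d + d <= n - s.
  have /dvdnP[[|[|b]] E] : d %| n - s by rewrite dvdn_sub ?dvdn_gcdr.
  - by move: gcd_lt; rewrite E.
  - by move: gcd_lt; rewrite E mul1n ltnn.
  - by rewrite E; lia.
have le_rn : r <= n by lia.
rewrite -(rotwK y le_rn).
apply: closed_rotw_gcd; first by rewrite dvdn_sub.
apply: (@closed_prefix (rotw r x)); first exact: closed_rotw_gcd.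
  by rewrite !wt_rotw.
move=> i /andP[le_i lt_in]; rewrite !letter_rotw //.
have [lt_irn|le_irn] := ltnP (i + r) n.
  by rewrite modn_small // eq_xy //; lia.
have -> : (i + r) %% n = i + r - n.
  by rewrite -[in LHS](subnK le_irn) modnDr modn_small //; lia.
by apply: eq_xy; lia.
Qed.

(** Adjacent changes are reversible, so the complement of [A] among the words of weight [k] is
    closed under them too. If nonempty, both sets would contain the unique left-packed word of
    weight [k]. *)
Lemma closed_full : A != set0 -> words_of_weight k m.+1 n \subset A.
Proof.
move=> A_neq0.
have wtA x : x \in A -> wt x = k by move/(subsetP AS); rewrite inE => /eqP.
have wtT x p : p.+1 < n -> letter x p < m -> 0 < letter x p.+1 ->
    wt (transfer p.+1 p x) = wt x.
  by move=> *; apply: wt_transfer => //; lia.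
have eqT x p i : letter x p < m -> i < n -> i != p -> i != p.+1 ->
    letter (transfer p.+1 p x) i = letter x i.
  by move=> *; rewrite letter_transfer //; lia.
have [x xA xP] : exists2 x, x \in A & left_packed x.
  apply: left_packed_exists => // x p xA lt_pn lt_xm x_gt0.
  apply: (closed_adjacent xA _ lt_pn); first by rewrite wtT.
  by move=> *; rewrite eqT.
rewrite -setD_eq0; apply: contraT => D_neq0.
have [y /setDP[yS yA] yP] :
    exists2 y, y \in words_of_weight k m.+1 n :\: A & left_packed y.
  apply: left_packed_exists => // y p /setDP[yS yA] lt_pn lt_ym y_gt0.
  rewrite inE; apply/andP; split; last by move: yS; rewrite !inE wtT.
  apply: contra yA => tA; apply: (closed_adjacent tA _ lt_pn); first by rewrite wtT.
  by move=> *; rewrite eqT.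
rewrite inE in yS; case/negP: yA; rewrite -(left_packed_inj xP yP) //.
by rewrite (wtA x xA) (eqP yS).
Qed.

End Connectivity.

Lemma ocycle_exists m n s k : s < n -> gcdn n s < n - s ->
  exists c, is_ocycle s (words_of_weight k m.+1 n) c.
Proof.
move=> lt_sn gcd_lt.
have rot_inj : injective (@rotw m n (n - s)).
  by apply: (can_inj (g := rotw (n - (n - s)))) => x; rewrite rotwK ?leq_subr.
have rot_src x : take s (@rotw m n (n - s) x) = drop (n - s) x :> seq 'I_m.+1.
  apply/esym/eqP/(overlapP _ _ (ltnW lt_sn)) => i lt_is.
  by rewrite letter_rotw ?modn_small; [congr letter| |]; lia.
case: (@euler_circuit _ _ (fun x : n.-tuple 'I_m.+1 => take s x)
  (fun x => drop (n - s) x) (words_of_weight k m.+1 n) _ rot_inj _ rot_src) => [x|A A0 AS A_closed|c cP].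
- by rewrite !inE wt_rotw.
- apply: (closed_full lt_sn gcd_lt AS) => // x y xA yS /eqP; exact: A_closed.
- by exists c.
Qed.

(** * Block weights as an obstruction when n - s = gcd(n, s) *)

Lemma word_of_weight_exists m n k : k <= n * m ->
  exists x, x \in words_of_weight k m.+1 n.
Proof.
move=> le_k; exists (word_of m n (fun i => minn m (k - i * m))); rewrite inE wtE.
under eq_bigr do rewrite letter_word ?geq_minl //.
suff -> : \sum_(i < n) minn m (k - i * m) = minn k (n * m) by apply/eqP; lia.
elim: n {le_k} => [|n IH]; first by rewrite big_ord0; lia.
by rewrite big_ord_recr /= IH mulSn; lia.
Qed.

Lemma eq_last_of_shift N (f g : nat -> nat) l :
  \sum_(j < N) f j = \sum_(j < N) g j ->
  (forall j, j.+1 < N -> g j = f j.+1) -> l.+1 = N -> g l = f 0.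
Proof.
move=> eq_sum shift N_eq; subst N; move: eq_sum.
rewrite big_ord_recl [RHS]big_ord_recr /=.
rewrite (eq_bigr (fun j : 'I_l => g j)) => [|j _]; first by lia.
by rewrite shift ?ltnS.
Qed.

Section Blocks.

Variables m N d : nat.
Local Notation n := (N * d).
Implicit Types x y : n.-tuple 'I_m.+1.

Definition block x i := \sum_(i * d <= j < i.+1 * d) letter x j.

Lemma blockE x i : block x i = \sum_(t < d) letter x (i * d + t).
Proof.
rewrite /block mulSn -{1}[i * d]add0n big_addn addnK big_mkord.
by apply: eq_bigr => t _; rewrite addnC.
Qed.

Lemma sum_block x : \sum_(i < N) block x i = wt x.
Proof.
by rewrite wtE -(big_mkord xpredT (letter x)) big_nat_mul big_mkord.
Qed.

Lemma block_le x i : block x i <= m * d.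
Proof.
have -> : m * d = \sum_(t < d) m by rewrite sum_nat_const card_ord mulnC.
by rewrite blockE; apply: leq_sum => t _; apply: letter_le.
Qed.

(** The overlap consists of [N - 1] whole blocks, which gives every block of [y] but the last;
    equality of the weights determines that one. *)
Lemma block_overlap x y (i : 'I_N) : overlap (n - d) x y -> wt x = wt y ->
  block y i = block x (ordS i).
Proof.
move=> /overlapP - /(_ (leq_subr _ _)) xy eq_wt.
have lt_overlap j : j.+1 < N -> block y j = block x j.+1.
  move=> lt_jN; rewrite !blockE; apply: eq_bigr => t _; rewrite -xy.
    by congr letter; have := leq_mul2r d 1 N; have := ltn_ord t; rewrite mulSn; nia.
  by have := ltn_ord t; nia.
have [lt_iN|ge_iN] := ltnP i.+1 N; first by rewrite lt_overlap //= modn_small.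
have N_eq : i.+1 = N by have := ltn_ord i; lia.
rewrite /= N_eq modnn; apply: (eq_last_of_shift _ lt_overlap N_eq).
by rewrite !sum_block.
Qed.

(** An invariant of cyclic shifts of the block weights. Squares of single blocks and products of
    neighbouring blocks are the two instances used. *)
Definition cyclic_sum (phi : nat -> nat -> nat) x :=
  \sum_(i < N) phi (block x i) (block x (ordS i)).

Lemma cyclic_sum_overlap phi x y : overlap (n - d) x y -> wt x = wt y ->
  cyclic_sum phi x = cyclic_sum phi y.
Proof.
move=> xy eq_wt; rewrite /cyclic_sum (reindex_inj (@ordS_inj N)).
by apply: eq_bigr => i _; rewrite !(block_overlap _ xy eq_wt).
Qed.

Lemma ocycle_cyclic_sum k c phi x y :
  is_ocycle (n - d) (words_of_weight k m.+1 n) c ->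
  x \in words_of_weight k m.+1 n -> y \in words_of_weight k m.+1 n ->
  cyclic_sum phi x = cyclic_sum phi y.
Proof.
case=> _ cS c_cycle; rewrite -!cS => xc yc.
pose r : rel (n.-tuple 'I_m.+1) := fun x y => cyclic_sum phi x == cyclic_sum phi y.
have r_trans : transitive r by move=> u v w /eqP vu /eqP uw; rewrite /r vu uw.
have : path.cycle r c.
  apply: (sub_in_cycle (P := mem c)) c_cycle; last by apply/allP.
  move=> u v uc vc uv; rewrite !cS !inE in uc vc.
  by apply/eqP/cyclic_sum_overlap; rewrite // (eqP uc) (eqP vc).
by rewrite cycle_all2rel // => /allrelP/(_ x y xc yc)/eqP.
Qed.

(* Moving a unit from block [i] to block [j] changes the sum of the squared block
   weights by [2 * (block x j - block x i) + 2], which therefore vanishes. *)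
Lemma exchange_blocks k c x (i j : 'I_N) :
  is_ocycle (n - d) (words_of_weight k m.+1 n) c ->
  x \in words_of_weight k m.+1 n -> i != j ->
  0 < block x i -> block x j < m * d -> block x i = (block x j).+1.
Proof.
move=> c_cycle xS neq_ij; rewrite {1}blockE => bi_gt0 bj_lt.
have [t t_gt0] : exists t : 'I_d, 0 < letter x (i * d + t).
  apply/existsP; apply: contraLR bi_gt0; rewrite negb_exists -leqNgt => /forallP x0.
  by rewrite leqn0 big1 // => t _; apply/eqP; rewrite -leqn0 leqNgt.
have [u u_lt] : exists u : 'I_d, letter x (j * d + u) < m.
  apply/existsP; apply: contraLR bj_lt; rewrite negb_exists -leqNgt => /forallP xm.
  have -> : m * d = \sum_(u < d) m by rewrite sum_nat_const card_ord mulnC.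
  by rewrite blockE; apply: leq_sum => u _; rewrite leqNgt.
set p := i * d + t in t_gt0; set q := j * d + u in u_lt.
have in_block (a b : nat) (v : 'I_d) : (b * d <= a * d + v < b.+1 * d) = (b == a).
  have := ltn_ord v; have [->|] := eqVneq b a; first by rewrite mulSn; lia.
  by move=> neq_ba lt_vd; apply/negP; case: (ltngtP a b) neq_ba => //; nia.
have neq_pq : p != q.
  apply: contra neq_ij => /eqP eq_pq; have := in_block i j t.
  by rewrite -/p eq_pq in_block eqxx => /esym/eqP/val_inj->.
have lt_pn : p < n by have := ltn_ord i; have := ltn_ord t; rewrite /p; nia.
have lt_qn : q < n by have := ltn_ord j; have := ltn_ord u; rewrite /q; nia.
pose y := transfer p q x.
have block_y (l : 'I_N) : block y l + (l == i) = block x l + (l == j).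
  have := sum_transfer (l * d) (l.+1 * d) neq_pq t_gt0; rewrite !in_block => <-.
  congr (_ + _); apply: eq_big_nat => e /andP[_ lt_e]; apply: letter_transfer => //.
  by have := ltn_ord l; nia.
have yS : y \in words_of_weight k m.+1 n.
  by move: xS; rewrite !inE wt_transfer.
have := ocycle_cyclic_sum (fun a _ => a * a) c_cycle xS yS.
rewrite /cyclic_sum => eq_sum.
have sum_delta (l : 'I_N) (e : nat) : \sum_(i0 < N) e * (i0 == l) = e.
  by rewrite (bigD1 l) //= eqxx muln1 big1 ?addn0 // => l' /negbTE->; rewrite muln0.
(* The added terms compensate (b - 1)^2 = b^2 - (2b - 1) at [i] and (b + 1)^2 = b^2 + (2b + 1) at
   [j], avoiding negative quantities. *)
have : \sum_(l < N) (block y l * block y l)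
       + \sum_(l < N) (2 * block x i - 1) * (l == i)
     = \sum_(l < N) (block x l * block x l)
       + \sum_(l < N) (2 * block x j + 1) * (l == j).
  rewrite -!big_split; apply: eq_bigr => l _ /=.
  have := block_y l; have [->|neq_li] := eqVneq l i.
    rewrite (negbTE neq_ij); move: bi_gt0; rewrite -blockE; nia.
  by case: (eqVneq l j) => [->|_]; nia.
by rewrite !sum_delta; move: bi_gt0; rewrite -blockE; lia.
Qed.

End Blocks.

(** Rigidity forces the sum to be 0, 1, [N * C - 1] or [N * C]. For [C = 1] every 0-1 sequence is
    rigid, hence the separate binary case. *)
Lemma rigid_sequence_false (N C k : nat) (a : 'I_N -> nat) :
  1 < N -> 1 < C -> (forall i, a i <= C) -> \sum_(i < N) a i = k ->
  1 < k < N * C - 1 ->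
  ~ (forall i j, i != j -> 0 < a i -> a j < C -> a i = (a j).+1).
Proof.
move=> N_gt1 C_gt1 aC sum_a k_bounds rigid.
have sumD1 i e : (forall l, l != i -> a l = e) -> k = a i + N.-1 * e.
  move=> a_e; rewrite -sum_a (bigD1 i) //= (eq_bigr (fun=> e)) //.
  by rewrite sum_nat_const cardC1 card_ord.
have [i ai_gt0] : exists i, 0 < a i.
  apply/existsP; apply: contraT; rewrite negb_exists => /forallP a0.
  by move: sum_a; rewrite big1 => [|i _]; [|have := a0 i]; lia.
have [/existsP[j /andP[neq_ji aj_lt]]|] := boolP [exists j, (j != i) && (a j < C)].
  have ij : a i = (a j).+1 by apply: rigid; rewrite 1?eq_sym.
  have [aj0|aj_gt0] := posnP (a j).
    suff /sumD1 : forall l, l != i -> a l = 0 by lia.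
    move=> l neq_li; have [->//|neq_lj] := eqVneq l j.
    have := rigid l j neq_lj; have := rigid i l; rewrite eq_sym neq_li.
    have := aC l; lia.
  suff /sumD1 : forall l, l != j -> a l = C.
    by have := rigid j i neq_ji aj_gt0; have := aC i; nia.
  move=> l neq_lj; have ji := rigid j i neq_ji aj_gt0; have aiC := aC i.
  have [->|neq_li] := eqVneq l i; first by lia.
  have := rigid l j neq_lj; have := rigid i l; rewrite eq_sym neq_li.
  have := aC l; lia.
rewrite negb_exists => /forallP aC'.
have a_eq l : l != i -> a l = C by have := aC' l; have := aC l; case: eqP => //=; lia.
have kE := sumD1 i C a_eq.
have [j neq_ji] : exists j, j != i.
  by apply/card_gt0P; rewrite cardC1 card_ord; lia.
have := rigid j i neq_ji; rewrite (a_eq j) //; nia.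
Qed.

(* The words [1^k 0^(n-k)] and [1^(k-1) 0 1 0^(n-k-1)] have different numbers of
   cyclic occurrences of [11].  The factor [1] is the block length. *)
Lemma no_binary_ocycle n k c : 1 < k < n - 1 ->
  ~ is_ocycle (n * 1 - 1) (words_of_weight k 2 (n * 1)) c.
Proof.
move=> k_bounds c_cycle.
have sum_lt e l : e <= l -> \sum_(i < l) (i < e) = e.
  move=> le_el; rewrite -[RHS]card_ord -sum1_card (big_ord_widen _ (fun=> 1) le_el).
  by rewrite [RHS]big_mkcond; apply: eq_bigr => i _; case: ltnP.
pose f i := nat_of_bool (i < k).
pose g i := (i < k.-1) + (i == k).
pose x := word_of 1 (n * 1) f; pose y := word_of 1 (n * 1) g.
have fle i : f i <= 1 by rewrite /f; case: ltnP.
have gle i : g i <= 1 by rewrite /g; lia.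
have xS : x \in words_of_weight k 2 (n * 1).
  rewrite inE wtE; apply/eqP; rewrite -[RHS](sum_lt k (n * 1)); last lia.
  by apply: eq_bigr => i _; rewrite letter_word.
have yS : y \in words_of_weight k 2 (n * 1).
  rewrite inE wtE (eq_bigr (fun i : 'I_(n * 1) => g i)) => [|i _];
    last by rewrite letter_word.
  have lt_kn : k < n * 1 by lia.
  rewrite big_split /= sum_lt; last lia.
  rewrite (bigD1 (Ordinal lt_kn)) //= eqxx big1 => [|i]; first by lia.
  by rewrite -val_eqE /= => /negbTE->.
have blockx h (i : 'I_n) : (forall l, h l <= 1) -> block (word_of 1 (n * 1) h) i = h i.
  by move=> hle; rewrite blockE big_ord1 muln1 addn0 letter_word ?muln1.
have := ocycle_cyclic_sum muln c_cycle xS yS; rewrite /cyclic_sum.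
have succE (i : 'I_n) : i.+1 %% n = i.+1 \/ i.+1 %% n = 0 /\ i = n.-1 :> nat.
  have [lt_in|ge_in] := ltnP i.+1 n; first by left; rewrite modn_small.
  have i_eq : i.+1 = n by have := ltn_ord i; lia.
  by right; split; [rewrite i_eq modnn|lia].
(* Since [k < n - 1], both words end in 0 and no 11 wraps around; the counts are [k.-1] for [x] and
   [k.-2] for [y]. *)
rewrite (eq_bigr (fun i : 'I_n => nat_of_bool (i < k.-1))) => [|i _]; last first.
  by rewrite !blockx // /f /=; case: (succE i) => [->|[-> ->]]; nia.
rewrite [RHS](eq_bigr (fun i : 'I_n => nat_of_bool (i < k.-2))) => [|i _]; last first.
  by rewrite !blockx // /g /=; case: (succE i) => [->|[-> ->]]; nia.
by rewrite !sum_lt; lia.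
Qed.

Theorem theorem3p4 (n m k s : nat)
  (n_gt0 : 0 < n) (m_gt0 : 0 < m) (k_gt0 : 0 < k) (s_gt0 : 0 < s)
  (s_bounds : 1 <= s <= n - 1) (k_bounds : 1 < k < (m - 1) * n - 1) :
  (exists c : seq (n.-tuple 'I_m), is_ocycle s (words_of_weight k m n) c)
  <-> n - s > gcdn n s.
Proof.
case: m m_gt0 k_bounds => // m _; rewrite !subn1 /= => k_bounds.
have lt_sn : s < n by lia.
split=> [[c c_cycle]|]; last exact: ocycle_exists.
rewrite ltnNge; apply/negP => le_gcd.
have dn : gcdn n s %| n by apply: dvdn_gcdl.
have d_eq : n - s = gcdn n s.
  apply/eqP; rewrite eqn_leq le_gcd dvdn_leq ?subn_gt0 //.
  by rewrite dvdn_sub ?dvdn_gcdr.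
have d_gt0 : 0 < gcdn n s by lia.
have s_eq : s = n - gcdn n s by lia.
move: d_gt0 dn s_eq; move: (gcdn n s) => d d_gt0 /dvdnP[N n_eq] s_eq.
clear d_eq le_gcd; subst s n.
have N_gt1 : 1 < N by nia.
(* [m * d] is the largest block weight. The bounds on [k] exclude 0, and the value 1 means binary
   words with blocks of length one. *)
have [C_gt1|C_le1] := ltnP 1 (m * d).
  have [|x xS] := @word_of_weight_exists m (N * d) k; first by nia.
  apply: (@rigid_sequence_false N (m * d) k (block x)) => //.
  - by move=> i; apply: block_le.
  - by rewrite sum_block; move: xS; rewrite inE => /eqP.
  - by rewrite mulnCA subn1.
  - by move=> i j; apply: exchange_blocks c_cycle xS.
have /eqP : m * d = 1.
  by move: k_bounds; rewrite mulnCA; case: (m * d) C_le1 => [|[|]] //;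
    rewrite muln0 andbF.
rewrite muln_eq1 => /andP[/eqP m_eq /eqP d_eq]; subst m d.
by apply: no_binary_ocycle c_cycle; lia.
Qed.
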